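(* Let $S$ be a measurable space and let $\mathcal{F}$ be a universally bounded set of measurable real-valued functions on $S$. For $1\le n\le\infty$, let $P_n$ be a transition kernel on $S$ that possesses a unique stationary distribution $\pi_n$ and has the $\mathcal{F}$ inclusion property. Assume that for each $x\in S$: (i) $\| P_{n,x}(X_1\in\cdot)-P_{\infty,x}(X_1\in\cdot)\|_{\mathcal{F}}\to 0$ as $n\to\infty$; (ii) $\| P_{\infty,x}(X_m\in\cdot)-\pi_\infty(\cdot)\|_{\mathcal{F}}\to 0$ as $m\to\infty$; (iii) $\|\pi_n-\pi_\infty\|_{\mathcal{F}}\to 0$ as $n\to\infty$. Then, for each $x\in S$, $$\sup_{m\ge 0}\| P_{n,x}(X_m\in\cdot)-P_{\infty,x}(X_m\in\cdot)\|_{\mathcal{F}}\to 0\quad\text{as } n\to\infty.$$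
   Context: The index $n$ ranges over $\{1,2,\dots\}\cup\{\infty\}$. For $x\in S$, $P_{n,x}$ is the probability on path space $S^\infty$ under which the coordinate process $X=(X_m:m\ge 0)$ is a Markov chain with $X_0=x$ and one-step transition kernel $P_n=(P_n(y,dz):y,z\in S)$. A stationary distribution of $P_n$ is a probability $\pi_n$ on $S$ with $\int_S\pi_n(dy)P_n(y,\cdot)=\pi_n(\cdot)$. For a finite signed measure $\nu$ on $S$ and a set $\mathcal{F}$ of bounded measurable real-valued functions, $\|\nu\|_{\mathcal{F}}=\sup_{f\in\mathcal{F}}\left|\int_S f(x)\,\nu(dx)\right|$ (in general this need not be a norm). $\mathcal{F}$ is universally bounded if $\sup\{|f(x)|:x\in S,\ f\in\mathcal{F}\}<\infty$. A transition kernel $Q$ on $S$ has the $\mathcal{F}$ inclusion property if $Qf\in\mathcal{F}$ whenever $f\in\mathcal{F}$, where $(Qf)(x)=\int_S f(y)\,Q(x,dy)$. *)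

(* Defs.v *)
From HB Require Import structures.
From mathcomp Require Import all_boot all_order all_algebra.
From mathcomp Require Import all_classical all_reals all_analysis.

Set Implicit Arguments.
Unset Strict Implicit.
Unset Printing Implicit Defensive.

Import Order.TTheory GRing.Theory Num.Theory.
Import numFieldNormedType.Exports.

Local Open Scope classical_set_scope.
Local Open Scope ring_scope.
Local Open Scope ereal_scope.

Section signed_integral.
Context d (S : measurableType d) (R : realType).
Implicit Types (nu : {charge set S -> \bar R}) (f : S -> R)
  (F : set (S -> R)) (p q : probability S R).

Definition hahn_pos nu : set S := projT1 (cid (Hahn_decomposition nu)).

Definition hahn_neg nu : set S :=
  projT1 (cid (projT2 (cid (Hahn_decomposition nu)))).

Lemma hahn_pos_neg nu : hahn_decomposition nu (hahn_pos nu) (hahn_neg nu).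
Proof. exact: projT2 (cid (projT2 (cid (Hahn_decomposition nu)))). Qed.

(* The integral against a signed measure is taken through its Jordan
   decomposition; it does not depend on the chosen Hahn decomposition, since
   two such decompositions differ by a nu-null set. *)
Definition charge_integral nu f : \bar R :=
  \int[jordan_pos (hahn_pos_neg nu)]_x (f x)%:E
  - \int[jordan_neg (hahn_pos_neg nu)]_x (f x)%:E.

(* The supremum is taken in [0, +oo], so that it is 0 for an empty F
   (ereal_sup set0 is -oo). *)
Definition fnorm F nu : \bar R :=
  maxe 0 (ereal_sup [set `|charge_integral nu f| | f in F]).

Definition prob_diff p q : {charge set S -> \bar R} :=
  cadd (charge_of_finite_measure p) (copp (charge_of_finite_measure q)).

Definition universally_bounded F :=
  exists M : R, forall f x, F f -> (`|f x| <= M)%R.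

End signed_integral.

Section kernels.
Context d (S : measurableType d) (R : realType).
Implicit Types (Q : R.-pker S ~> S) (F : set (S -> R)) (p : probability S R).

Definition kernel_op Q (f : S -> R) : S -> R := fun x => (\int[Q x]_y f y)%R.

Definition inclusion_property F Q := forall f, F f -> F (kernel_op Q f).

Definition stationary Q p :=
  forall A, measurable A -> \int[p]_y Q y A = p A.

(* Uniqueness is up to equality on measurable sets: the underlying set function
   of a measure is unconstrained elsewhere. *)
Definition unique_stationary Q p :=
  stationary Q p /\
  forall p', stationary Q p' -> forall A, measurable A -> p' A = p A.

End kernels.

Section path_space.
Context d (S : measurableType d).

Definition cylinders (I : set nat) : set (set (nat -> S)) :=
  [set C | exists k, I k /\
     exists2 B, measurable B & C = (fun w : nat -> S => w k) @^-1` B].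

(* S^oo with the product sigma-algebra *)
Definition path_space : Type := g_sigma_algebraType (cylinders setT).

HB.instance Definition _ := Measurable.on path_space.

Definition Xcoord (m : nat) (w : path_space) : S := w m.

Let measurable_Xcoord m : measurable_fun setT (Xcoord m).
Proof.
move=> _ B mB; rewrite setTI; apply: sub_sigma_algebra.
by exists m; split => //; exists B.
Qed.

HB.instance Definition _ m :=
  isMeasurableFun.Build _ _ _ _ (Xcoord m) (measurable_Xcoord m).

(* the sigma-algebra generated by X_0, ..., X_m *)
Definition past (m : nat) : set (set path_space) :=
  <<s cylinders [set k | (k <= m)%N] >>.

(* mu is the law on path space under which the coordinate process is a Markov
   chain with X_0 = x and transition kernel Q. The last clause is
   mu(X_{m+1} \in B | X_0, ..., X_m) = Q(X_m, B) a.s., the conditional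
   probability being spelled out through its defining property. *)
Definition markov_law (R : realType) (Q : R.-pker S ~> S) (x : S)
    (mu : probability path_space R) : Prop :=
  (forall B, measurable B -> distribution mu (Xcoord 0) B = \d_x B) /\
  (forall m A B, past m A -> measurable B ->
     mu (A `&` Xcoord m.+1 @^-1` B) = \int[mu]_(w in A) Q (Xcoord m w) B).

End path_space.
Arguments Xcoord {d S} m.

(* Main.v *)
(* For fixed m, induction on m and the F inclusion property split
   P_n^(m+1) f - P_oo^(m+1) f into (P_n^m - P_oo^m)(P_n f), controlled by the
   previous step, and P_oo^m (P_n f - P_oo f), controlled by (i) and dominated
   convergence.  Uniformity in m comes from the inclusion property as well: it
   makes the F-distances to equilibrium ||P_n^m(x) - pi_n|| and
   ||P_oo^m(x) - pi_oo|| nonincreasing in m, so that for m >= m0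
     ||P_n^m(x) - P_oo^m(x)|| <= ||P_n^m0(x) - P_oo^m0(x)||
       + 2 ||P_oo^m0(x) - pi_oo|| + 2 ||pi_n - pi_oo||. *)
From HB Require Import structures.
Require Import Defs.
From mathcomp Require Import all_boot all_order all_algebra.
From mathcomp Require Import all_classical all_reals all_analysis.
From mathcomp Require Import measurable_realfun giry lra.

Import Order.TTheory GRing.Theory Num.Theory.
Import numFieldNormedType.Exports.

Set Implicit Arguments.
Unset Strict Implicit.
Unset Printing Implicit Defensive.

Local Open Scope classical_set_scope.
Local Open Scope ring_scope.
Local Open Scope ereal_scope.

(** * Integrals of bounded functions and the F-distance of probabilities *)

Lemma fin_num_subr_eq (R : realType) (a b c e : \bar R) :
  a \is a fin_num -> b \is a fin_num -> c \is a fin_num -> e \is a fin_num ->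
  (a - b = c - e <-> a + e = b + c).
Proof.
case: a b c e => [a||] [b||] [c||] [e||]// _ _ _ _.
by rewrite -!EFinB -!EFinD; split=> -[abce]; congr EFin; lra.
Qed.

Section integrals.
Context {d} {S : measurableType d} {R : realType}.
Implicit Types (f : S -> R) (F : set (S -> R)) (p q : probability S R).

Lemma integrable_bounded (mu : {finite_measure set S -> \bar R}) f (M : R) :
  measurable_fun setT f -> (forall x, `|f x| <= M)%R ->
  mu.-integrable setT (EFin \o f).
Proof.
move=> mf fM; apply: measurable_bounded_integrable => //.
  by rewrite ltey_eq fin_num_measure.
exists M; split; first exact: num_real.
by move=> y My x _ /=; rewrite (le_trans (fM x))// ltW.
Qed.

Lemma normr_Rintegral_le p f (M : R) :
  measurable_fun setT f -> (forall x, `|f x| <= M)%R ->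
  (`|\int[p]_x f x| <= M)%R.
Proof.
move=> mf fM; have fi := integrable_bounded p mf fM.
rewrite (le_trans (le_normr_Rintegral measurableT fi))//.
have <- : (\int[p]_x M)%R = M.
  by rewrite (Rintegral_cst p measurableT) [X in fine X](probability_setT p) mulr1.
apply: le_Rintegral => //.
- by apply: (integrable_bounded p _ (M := M)) => [|x]; [exact: measurableT_comp|
    rewrite normr_id].
- by apply: (integrable_bounded p _ (M := `|M|%R)) => // x; exact: measurable_cst.
Qed.

Lemma RintegralD_cst p f (M : R) :
  measurable_fun setT f -> (forall x, `|f x| <= M)%R ->
  (\int[p]_x (f x + M) = \int[p]_x f x + M)%R.
Proof.
move=> mf fM; rewrite (@RintegralD _ _ _ p)//.
- by rewrite (Rintegral_cst p measurableT) [X in fine X](probability_setT p) mulr1.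
- exact: (integrable_bounded p mf fM).
- by apply: (integrable_bounded p _ (M := `|M|%R)) => // ?; exact: measurable_cst.
Qed.

(** Moving the negative terms across gives [p + neg = q + pos], an identity of measures, in which
    the integral is additive. Since [f] is bounded, all four integrals are finite and the terms can
    be moved back. *)
Lemma integral_measureB (p q pos neg : {finite_measure set S -> \bar R}) f
    (M : R) :
  (forall A, measurable A -> p A - q A = pos A - neg A) ->
  measurable_fun setT f -> (forall x, `|f x| <= M)%R ->
  \int[pos]_x (f x)%:E - \int[neg]_x (f x)%:E =
  (\int[p]_x f x - \int[q]_x f x)%:E.
Proof.
move=> pqE mf fM.
have ip := integrable_bounded p mf fM.
have iq := integrable_bounded q mf fM.
have ipos := integrable_bounded pos mf fM.
have ineg := integrable_bounded neg mf fM.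
have : \int[measure_add p neg]_x (f x)%:E = \int[measure_add q pos]_x (f x)%:E.
  apply: eq_measure_integral => A mA _.
  rewrite [LHS](measure_addE p neg) [RHS](measure_addE q pos).
  by apply/fin_num_subr_eq; [exact: fin_num_measure..|exact: pqE].
rewrite !(integral_measure_add measurableT)// => pqI.
rewrite /Rintegral EFinB !fineK; try exact: integrable_fin_num.
by symmetry; apply/fin_num_subr_eq => //; exact: integrable_fin_num.
Qed.

Lemma charge_integral_prob_diff p q f (M : R) :
  measurable_fun setT f -> (forall x, `|f x| <= M)%R ->
  charge_integral (prob_diff p q) f = (\int[p]_x f x - \int[q]_x f x)%:E.
Proof.
move=> mf fM; apply: (integral_measureB (M := M)) => // A mA.
have := jordan_decomp (hahn_pos_neg (prob_diff p q)) mA.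
by rewrite /cadd/= cscaleN1.
Qed.

Lemma fnorm_ge0 F (nu : {charge set S -> \bar R}) : 0 <= fnorm F nu.
Proof. by rewrite /fnorm le_max lexx. Qed.

(** The condition [0 <= e] matches the [maxe 0] in [fnorm]: for empty [F] the right-hand side is
    vacuous while [fnorm] is 0. *)
Lemma fnorm_prob_diff_le F (M : R) p q (e : R) :
  (forall f, F f -> measurable_fun setT f) ->
  (forall f x, F f -> `|f x| <= M)%R -> (0 <= e)%R ->
  (fnorm F (prob_diff p q) <= e%:E <->
   forall f, F f -> (`|\int[p]_x f x - \int[q]_x f x| <= e)%R).
Proof.
move=> mF FM e0; rewrite /fnorm ge_max lee_fin e0/=; split=> [Fe f Ff|Fe].
  rewrite -lee_fin; apply: le_trans Fe; apply: ereal_sup_ubound.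
  by exists f => //;
    rewrite (charge_integral_prob_diff p q (mF _ Ff) (fun x => FM f x Ff)).
apply: ge_ereal_sup => _ [f Ff <-].
rewrite (charge_integral_prob_diff p q (mF _ Ff) (fun x => FM f x Ff)).
by rewrite lee_fin Fe.
Qed.

End integrals.

Lemma cvge0_nneg (R : realType) (u : (\bar R)^nat) : (forall n, 0 <= u n) ->
  (u n @[n --> \oo] --> 0 <->
   forall e : R, (0 < e)%R -> \forall n \near \oo, u n <= e%:E).
Proof.
move=> u0; split=> [u0' e e0|ue].
  have e0' : 0%:E < e%:E by rewrite lte_fin.
  have une : \forall n \near \oo, u n < e%:E.
    exact (u0' [set y | y < e%:E] (open_ereal_lt' e0')).
  by apply: filterS une => n; exact: ltW.
apply/fine_cvgP; split.
  (* The bound with [e = 1] makes [u n] eventually finite, so the limit can be taken in the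
     reals. *)
  apply: filterS (ue 1%R ltr01) => n un1.
  by rewrite ge0_fin_numE// (le_lt_trans un1)// ltry.
apply/cvgr0Pnorm_le => e e0; apply: filterS (ue e e0) => n une /=.
rewrite ger0_norm ?fine_ge0// -lee_fin fineK//.
by rewrite ge0_fin_numE// (le_lt_trans une)// ltry.
Qed.

(** * Action of a probability kernel on bounded functions *)

Section kernel_prob.
Context {d} {S : measurableType d} {R : realType} (Q : R.-pker S ~> S).

(* The values of a probability kernel are typed as bare measures; this alias
   carries their probability structure. *)
Let kprob x : set S -> \bar R := Q x.

HB.instance Definition _ x := Measure.on (kprob x).

Let kprobT x : kprob x setT = 1. Proof. exact: prob_kernel. Qed.

HB.instance Definition _ x :=
  Measure_isProbability.Build _ _ _ (kprob x) (kprobT x).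

Let kprob_measurable : measurable_fun setT (kprob : S -> giry S R).
Proof.
by apply: measurable_giry_codensity => // B mB; exact: measurable_kernel.
Qed.

Lemma kernel_op_bounded (f : S -> R) (M : R) : measurable_fun setT f ->
  (forall x, `|f x| <= M)%R -> forall x, (`|kernel_op Q f x| <= M)%R.
Proof. by move=> mf fM x; exact (normr_Rintegral_le (kprob x) mf fM). Qed.

(** The shift by [M] reduces bounded integrands to nonnegative ones, for which measurability of
    kernel integrals and integration against a Giry bind are stated. It commutes with [kernel_op Q]
    because [Q x] has mass 1. *)
Let kernel_op_add (f : S -> R) (M : R) (x : S) : measurable_fun setT f ->
  (forall x, `|f x| <= M)%R ->
  (kernel_op Q (fun y => f y + M) x = kernel_op Q f x + M)%R.
Proof. exact: (RintegralD_cst (kprob x)). Qed.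

Let nneg_shift (f : S -> R) (M : R) : (forall x, `|f x| <= M)%R ->
  forall x, 0 <= (f x + M)%:E.
Proof.
by move=> fM x; have := fM x; rewrite lee_fin ler_norml => /andP[? _]; lra.
Qed.

Let measurable_shift (f : S -> R) (M : R) : measurable_fun setT f ->
  measurable_fun setT (fun x => (f x + M)%:E).
Proof. by move=> mf; apply/measurable_EFinP; exact: measurable_funD. Qed.

Let integral_kernel_op (g : S -> R) (M : R) x : measurable_fun setT g ->
  (forall x, `|g x| <= M)%R -> \int[Q x]_y (g y)%:E = (kernel_op Q g x)%:E.
Proof.
move=> mg gM; rewrite /kernel_op /Rintegral fineK//.
have := integrable_bounded (kprob x) mg gM.
exact: integrable_fin_num.
Qed.

Lemma kernel_op_measurable (f : S -> R) (M : R) : measurable_fun setT f ->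
  (forall x, `|f x| <= M)%R -> measurable_fun setT (kernel_op Q f).
Proof.
move=> mf fM.
have -> : kernel_op Q f = (fun x => fine (\int[Q x]_y (f y + M)%:E) - M)%R.
  apply/funext => x; have := kernel_op_add x mf fM.
  by rewrite /kernel_op {1}/Rintegral => ->; rewrite addrK.
apply: measurable_funB => //.
apply: measurableT_comp; first exact: fine_measurable.
apply: (@measurable_fun_integral_kernel _ _ S S R Q _ (fun y => (f y + M)%:E)).
- by move=> U mU; exact: measurable_kernel.
- exact: nneg_shift.
- exact: measurable_shift.
Qed.

(** On measurable sets [p'] is the Giry bind of [p] along [Q], so this is the formula for
    integrating against a bind, applied to [f + M]. *)
Lemma Rintegral_kernel_op (p p' : probability S R) (f : S -> R) (M : R) :
  (forall A, measurable A -> p' A = \int[p]_x Q x A) ->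
  measurable_fun setT f -> (forall x, `|f x| <= M)%R ->
  (\int[p']_x f x = \int[p]_x kernel_op Q f x)%R.
Proof.
move=> p'E mf fM.
have mk := kernel_op_measurable mf fM.
have kM := kernel_op_bounded mf fM.
apply: (addIr M); rewrite -(RintegralD_cst p' mf fM)// -(RintegralD_cst p mk kM)//.
congr fine.
transitivity (giry_int (giry_bind p kprob_measurable) (fun x => (f x + M)%:E)).
  apply: eq_measure_integral => A mA _; apply: etrans (p'E A mA) _; symmetry.
  by apply: (giry_int_map kprob_measurable p (measurable_giry_ev mA)) => mu.
rewrite giry_int_bind; [|exact: measurable_shift|exact: nneg_shift].
apply: eq_integral => x _; rewrite -(kernel_op_add x mf fM).
(* [M + M] bounds [f + M] in absolute value; [M] is nonnegative since it dominates [|f y|]. *)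
rewrite -(@integral_kernel_op _ (M + M)%R)//.
  exact: measurable_funD.
by move=> y; rewrite (le_trans (ler_normD _ _))// lerD//
  ger0_norm// (le_trans _ (fM y)).
Qed.

End kernel_prob.

(** * Dominated convergence uniformly over varying classes of functions *)

Section uniform_integrals.
Context {d} {S : measurableType d} {R : realType}.

(* The envelope [sup_(g in G n) `|g x|] need not be measurable in [x], so
   dominated convergence is applied to a sequence of near-maximizers of
   [`|\int[p]_x g x|] instead. *)
Lemma near_Rintegral_unif (p : probability S R) (G : nat -> set (S -> R)) (C : R) :
  (forall n g, G n g -> measurable_fun setT g /\ forall x, `|g x| <= C)%R ->
  (forall x (e : R), (0 < e)%R ->
    \forall n \near \oo, forall g, G n g -> (`|g x| <= e)%R) ->
  forall e : R, (0 < e)%R ->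
    \forall n \near \oo, forall g, G n g -> (`|\int[p]_x g x| <= e)%R.
Proof.
move=> mG cvgG e e0.
pose bad n g := G n g /\ (e < `|\int[p]_x g x|)%R.
(* [h n] violates the bound [e] whenever some member of [G n] does, and is zero otherwise; one
   sequence thus tests all the classes. *)
have /choice[h hP] n : exists hn : S -> R,
    bad n hn \/ hn = cst 0%R /\ forall g, ~ bad n g.
  have [[g bg]|nb] := pselect (exists g, bad n g); first by exists g; left.
  by exists (cst 0%R); right; split => // g bg; apply: nb; exists g.
have mh n : measurable_fun setT (h n).
  by case: (hP n) => [[/mG[]]//|[-> _]]; exact: measurable_cst.
(* [C] itself may be negative when every [G n] is empty. *)
have hC n x : (`|h n x| <= `|C|)%R.
  case: (hP n) => [[/mG[_ hnC] _]|[-> _]]; last by rewrite normr0.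
  by rewrite (le_trans (hnC x))// ler_norm.
have h0 x : (h n x)%:E @[n --> \oo] --> 0.
  apply: cvg_EFin; first exact: nearW.
  apply/cvgr0Pnorm_le => a a0; apply: filterS (cvgG x a a0) => n na /=.
  case: (hP n) => [[Gh _]|[-> _]]; first exact: na.
  by rewrite normr0 ltW.
have intC : p.-integrable setT (EFin \o cst `|C|%R).
  apply: (integrable_bounded p (M := `|C|%R)); first exact: measurable_cst.
  by move=> x; rewrite normr_id.
have := @dominated_cvg _ _ _ p setT measurableT (fun n x => (h n x)%:E)
  (cst 0) (EFin \o cst `|C|%R).
move=> /(_ _ _ _ intC _)/= dom.
have {dom}: \int[p]_x (h n x)%:E @[n --> \oo] --> 0.
  rewrite -[X in _ --> X](integral0 p setT); apply: dom => //.
  - by move=> n; exact/measurable_EFinP.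
  - by move=> n x _; rewrite lee_fin.
move=> /fine_cvgP[_ /cvgr0Pnorm_le/(_ e e0)].
apply: filterS => n hne g Gg; rewrite leNgt; apply/negP => eg.
case: (hP n) => [[_]|[_ /(_ g)]]; last by apply.
by rewrite ltNge => /negP; apply; exact: hne.
Qed.

End uniform_integrals.

(** * Propagation of F-closeness along the chains *)

Section close.
Context {d} {S : measurableType d} {R : realType}.
Variables (F : set (S -> R)) (M : R).
Hypothesis mF : forall f, F f -> measurable_fun setT f.
Hypothesis FM : forall f x, F f -> (`|f x| <= M)%R.
Implicit Types (p q : probability S R) (Q : R.-pker S ~> S).

Definition Fclose (e : R) p q :=
  forall f, F f -> (`|\int[p]_x f x - \int[q]_x f x| <= e)%R.

Definition one_step Q p p' :=
  forall A, measurable A -> \int[p]_x Q x A = p' A.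

Lemma Fclose_sym e p q : Fclose e p q -> Fclose e q p.
Proof. by move=> pq f Ff; rewrite distrC pq. Qed.

Lemma Fclose_trans q p r a b :
  Fclose a p q -> Fclose b q r -> Fclose (a + b) p r.
Proof.
move=> pq qr f Ff; rewrite (le_trans (ler_distD (\int[q]_x f x)%R _ _))//.
by rewrite lerD ?pq ?qr.
Qed.

Lemma Fclose_le a b p q : (a <= b)%R -> Fclose a p q -> Fclose b p q.
Proof. by move=> ab pq f Ff; rewrite (le_trans (pq _ Ff)). Qed.

Lemma Rintegral_one_step Q p p' f : one_step Q p p' -> F f ->
  (\int[p']_x f x = \int[p]_x kernel_op Q f x)%R.
Proof.
move=> pp' Ff; apply: (@Rintegral_kernel_op _ _ _ Q p p' f M).
- by move=> A mA; rewrite pp'.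
- exact: mF.
- by move=> x; exact: FM.
Qed.

(** Testing [p'] and [q'] against [f] amounts to testing [p] and [q] against [kernel_op Q f], which
    is again in [F]. *)
Lemma Fclose_one_step Q p p' q q' e : inclusion_property F Q ->
  one_step Q p p' -> one_step Q q q' -> Fclose e p q -> Fclose e p' q'.
Proof.
move=> QF pp' qq' pq f Ff.
by rewrite (Rintegral_one_step pp' Ff) (Rintegral_one_step qq' Ff); exact/pq/QF.
Qed.

Lemma Fclose_stationary Q (p : nat -> probability S R) q e m k :
  inclusion_property F Q -> (forall i, one_step Q (p i) (p i.+1)) ->
  stationary Q q -> Fclose e (p m) q -> Fclose e (p (m + k)%N) q.
Proof.
move=> QF pQ qQ pq; elim: k => [|k IH]; first by rewrite addn0.
(* [stationary Q q] unfolds to [one_step Q q q], so [q] stays fixed while [p] advances. *)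
by rewrite addnS; apply: (Fclose_one_step QF (pQ _) qQ).
Qed.

Lemma near_Fclose_iterate (P : nat -> R.-pker S ~> S) (Poo : R.-pker S ~> S)
    (mu : nat -> nat -> probability S R) (muoo : nat -> probability S R) :
  (forall n, (1 <= n)%N -> inclusion_property F (P n)) ->
  inclusion_property F Poo ->
  (forall n m, (1 <= n)%N -> one_step (P n) (mu n m) (mu n m.+1)) ->
  (forall m, one_step Poo (muoo m) (muoo m.+1)) ->
  (forall x (e : R), (0 < e)%R -> \forall n \near \oo, forall f, F f ->
    (`|kernel_op (P n) f x - kernel_op Poo f x| <= e)%R) ->
  (forall n, (1 <= n)%N -> Fclose 0%R (mu n 0%N) (muoo 0%N)) ->
  forall m (e : R), (0 < e)%R -> \forall n \near \oo, Fclose e (mu n m) (muoo m).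
Proof.
move=> PF PooF muP muooP cvgP mu0; elim=> [|m IH] e e0.
  exists 1%N => // n /= n1; exact: Fclose_le (ltW e0) (mu0 n n1).
have e2 : (0 < e / 2)%R by rewrite divr_gt0.
(* With the differences of the two kernels as classes, (i) is exactly pointwise convergence uniform
   over [G n]. The clause [1 <= n] gives access to the inclusion property of [P n], whence the bound
   [M + M]. *)
pose G n := [set g : S -> R | (1 <= n)%N /\ exists2 f, F f &
  g = (kernel_op (P n) f \- kernel_op Poo f)%R].
have GM n g : G n g -> measurable_fun setT g /\ forall x, (`|g x| <= M + M)%R.
  move=> [n1 [f Ff ->]]; split=> [|x].
    by apply: measurable_funB; apply: mF; [exact: PF|exact: PooF].
  rewrite (le_trans (ler_normB _ _))// lerD// FM//; [exact: PF|exact: PooF].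
have G0 x (a : R) : (0 < a)%R ->
    \forall n \near \oo, forall g, G n g -> (`|g x| <= a)%R.
  by move=> a0; apply: filterS (cvgP x a a0) => n na g [_ [f Ff ->]]; exact: na.
have near1 : \forall n \near \oo, (1 <= n)%N by exists 1%N.
have near2 := near_Rintegral_unif (muoo m) GM G0 e2.
near=> n.
have n1 : (1 <= n)%N by near: n.
move=> f Ff.
rewrite (Rintegral_one_step (muP n m n1) Ff) (Rintegral_one_step (muooP m) Ff).
have PFf := PF _ n1 _ Ff; have PooFf := PooF _ Ff.
(* At this midpoint the first half falls to the induction hypothesis for [kernel_op (P n) f] and the
   second to [near2]. *)
rewrite (le_trans (ler_distD (\int[muoo m]_x kernel_op (P n) f x)%R _ _))//.
rewrite [leRHS](splitr e) lerD//.
  have : Fclose (e / 2) (mu n m) (muoo m) by near: n; exact: IH.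
  exact.
rewrite -RintegralB//; last 2 first.
- by apply: (integrable_bounded _ (M := M)) => [|x]; [exact: mF|exact: FM].
- by apply: (integrable_bounded _ (M := M)) => [|x]; [exact: mF|exact: FM].
have : forall g, G n g -> (`|\int[muoo m]_x g x| <= e / 2)%R.
  by near: n; exact: near2.
by apply; split => //; exists f.
Unshelve. all: by end_near. Qed.

Lemma near_Fclose_iterate_unif (P : nat -> R.-pker S ~> S) (Poo : R.-pker S ~> S)
    (pi : nat -> probability S R) (pioo : probability S R)
    (mu : nat -> nat -> probability S R) (muoo : nat -> probability S R) :
  (forall n, (1 <= n)%N -> inclusion_property F (P n)) ->
  inclusion_property F Poo ->
  (forall n, (1 <= n)%N -> stationary (P n) (pi n)) -> stationary Poo pioo ->
  (forall n m, (1 <= n)%N -> one_step (P n) (mu n m) (mu n m.+1)) ->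
  (forall m, one_step Poo (muoo m) (muoo m.+1)) ->
  (forall m (e : R), (0 < e)%R ->
    \forall n \near \oo, Fclose e (mu n m) (muoo m)) ->
  (forall e : R, (0 < e)%R -> \forall m \near \oo, Fclose e (muoo m) pioo) ->
  (forall e : R, (0 < e)%R -> \forall n \near \oo, Fclose e (pi n) pioo) ->
  forall e : R, (0 < e)%R ->
    \forall n \near \oo, forall m, Fclose e (mu n m) (muoo m).
Proof.
move=> PF PooF piP pioP muP muooP cvgmu cvgmuoo cvgpi e e0.
(* Late times cost five terms: three from [mu n m] to [pi n], one from [pi n] to [pioo], one from
   [pioo] to [muoo m]. *)
pose a := (e / 5)%R.
have a0 : (0 < a)%R by rewrite divr_gt0.
have [m0 _ /(_ m0 (leqnn m0)) /= muoo_m0] := cvgmuoo a a0.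
(* Finitely many times allow a common threshold in [n]; the index type includes [m0] itself, used
   below as [ord_max]. *)
have near_small : \forall n \near \oo,
    forall i : 'I_m0.+1, Fclose a (mu n i) (muoo i).
  by apply: filter_forall => i; exact: cvgmu.
near=> n.
have n1 : (1 <= n)%N by near: n; exists 1%N.
have small : forall i : 'I_m0.+1, Fclose a (mu n i) (muoo i).
  by near: n; exact: near_small.
have pin : Fclose a (pi n) pioo by near: n; exact: cvgpi.
have mun : Fclose (a + (a + a)) (mu n m0) (pi n).
  apply: Fclose_trans (small ord_max) _.
  exact: Fclose_trans muoo_m0 (Fclose_sym pin).
(* Beyond [m0], write [m = m0 + k] and carry the bounds at [m0] forward by stationarity. *)
move=> m; have [mm0|/ltnW/subnKC <-] := ltnP m m0.+1.
  apply: (@Fclose_le a) (small (Ordinal mm0)).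
  by rewrite /a; lra.
apply: (@Fclose_le ((a + (a + a)) + (a + a))%R); first by rewrite /a; lra.
apply: (@Fclose_trans (pi n)).
  apply: (Fclose_stationary _ (PF n n1) _ (piP n n1) mun) => i.
  exact: muP.
apply: Fclose_trans pin _; apply: Fclose_sym.
exact: (Fclose_stationary _ PooF muooP pioP muoo_m0).
Unshelve. all: by end_near. Qed.

End close.

(** * Marginals of a Markov law on path space *)

Section markov.
Context {d} {S : measurableType d} {R : realType}.

(** This is the Markov property at time [m] on the event of all paths, after a change of variables
    along [Xcoord m]. *)
Lemma markov_law_one_step (Q : R.-pker S ~> S) x mu m : markov_law Q x mu ->
  one_step Q (distribution mu (Xcoord m)) (distribution mu (Xcoord m.+1)).
Proof.
move=> [_ muQ] A mA.
rewrite ge0_integral_distribution//; last exact: measurable_kernel.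
have past_setT : past m (setT : set (path_space S)).
  exact: (@measurableT _ (g_sigma_algebraType
    (@cylinders _ S [set k | (k <= m)%N]))).
by have := muQ m setT A past_setT mA; rewrite setTI => /esym.
Qed.

Lemma Rintegral_markov_law0 (Q : R.-pker S ~> S) x mu (f : S -> R) :
  markov_law Q x mu ->
  measurable_fun setT f -> (\int[distribution mu (Xcoord 0)]_y f y = f x)%R.
Proof.
move=> [mu0 _] mf; rewrite /Rintegral (@eq_measure_integral _ _ _ _ (\d_x)).
  by rewrite integral_dirac//; [rewrite diracT mul1e|exact/measurable_EFinP].
by move=> A mA _; exact: mu0.
Qed.

End markov.

Unset Implicit Arguments.

Theorem theorem1 (R : realType) (d : measure_display) (S : measurableType d)
    (F : set (S -> R))
    (F_meas : forall f : S -> R, F f -> measurable_fun [set: S] f)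
    (F_bdd : universally_bounded F)
    (P : nat -> R.-pker S ~> S) (Poo : R.-pker S ~> S)
    (pi : nat -> probability S R) (pioo : probability S R)
    (pi_uniq : forall n : nat, (1 <= n)%N -> unique_stationary (P n) (pi n))
    (pioo_uniq : unique_stationary Poo pioo)
    (P_incl : forall n : nat, (1 <= n)%N -> inclusion_property F (P n))
    (Poo_incl : inclusion_property F Poo)
    (Pr : nat -> S -> probability (path_space S) R)
    (Proo : S -> probability (path_space S) R)
    (Pr_markov : forall (n : nat) (x : S),
      (1 <= n)%N -> markov_law (P n) x (Pr n x))
    (Proo_markov : forall x : S, markov_law Poo x (Proo x))
    (cvg_one_step : forall x : S,
      fnorm F (prob_diff (distribution (Pr n x) (Xcoord 1))
                         (distribution (Proo x) (Xcoord 1)))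
        @[n --> \oo] --> 0)
    (cvg_equilibrium : forall x : S,
      fnorm F (prob_diff (distribution (Proo x) (Xcoord m)) pioo)
        @[m --> \oo] --> 0)
    (cvg_stationary :
      fnorm F (prob_diff (pi n) pioo) @[n --> \oo] --> 0) :
  forall x : S,
    ereal_sup (range (fun m : nat =>
      fnorm F (prob_diff (distribution (Pr n x) (Xcoord m))
                         (distribution (Proo x) (Xcoord m)))))
      @[n --> \oo] --> 0.
Proof.
have [M FM] := F_bdd.
have fnormE p q (e : R) : (0 < e)%R ->
    (fnorm F (prob_diff p q) <= e%:E <-> Fclose F e p q).
  by move=> e0; apply: (fnorm_prob_diff_le (M := M)) => //; exact: ltW.
have closeP (p q : nat -> probability S R) :
    fnorm F (prob_diff (p n) (q n)) @[n --> \oo] --> 0 ->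
    forall e : R, (0 < e)%R -> \forall n \near \oo, Fclose F e (p n) (q n).
  move=> /cvge0_nneg pq e e0; apply: filterS (pq _ e e0) => [n|n].
    by move/fnormE; apply.
  exact: fnorm_ge0.
move=> x.
pose mu n m : probability S R := distribution (Pr n x) (Xcoord m).
pose muoo m : probability S R := distribution (Proo x) (Xcoord m).
have law0 n y f : (1 <= n)%N -> F f ->
    (\int[distribution (Pr n y) (Xcoord 0)]_z f z = f y)%R.
  by move=> n1 Ff; apply: (Rintegral_markov_law0 (Pr_markov n y n1)); exact: F_meas.
have lawoo0 y f : F f -> (\int[distribution (Proo y) (Xcoord 0)]_z f z = f y)%R.
  by move=> Ff; apply: (Rintegral_markov_law0 (Proo_markov y)); exact: F_meas.
(* Hypothesis (i) is turned from laws of X_1 into kernels: [kernel_op (P n) f y] is the integral of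
   that function against the law of X_0, hence of [f] against the law of X_1. Every [y] is needed,
   since the limit is later integrated over the state space. *)
have cvgP y (e : R) : (0 < e)%R -> \forall n \near \oo, forall f, F f ->
    (`|kernel_op (P n) f y - kernel_op Poo f y| <= e)%R.
  move=> e0; have near1 : \forall n \near \oo, (1 <= n)%N by exists 1%N.
  apply: filterS2 near1 (closeP _ _ (cvg_one_step y) e e0) => n n1 ne f Ff.
  rewrite -(law0 n y)//; last exact: P_incl.
  rewrite -(lawoo0 y); last exact: Poo_incl.
  rewrite -(Rintegral_one_step F_meas FM
    (markov_law_one_step 0 (Pr_markov n y n1)) Ff).
  rewrite -(Rintegral_one_step F_meas FM
    (markov_law_one_step 0 (Proo_markov y)) Ff).
  exact: ne.
have cvgmu := near_Fclose_iterate F_meas FM (mu := mu) (muoo := muoo)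
  P_incl Poo_incl (fun n m n1 => markov_law_one_step m (Pr_markov n x n1))
  (fun m => markov_law_one_step m (Proo_markov x)) cvgP.
have main := near_Fclose_iterate_unif F_meas FM (mu := mu) (muoo := muoo)
  P_incl Poo_incl (fun n n1 => proj1 (pi_uniq n n1)) (proj1 pioo_uniq)
  (fun n m n1 => markov_law_one_step m (Pr_markov n x n1))
  (fun m => markov_law_one_step m (Proo_markov x)) (cvgmu _)
  (closeP _ _ (cvg_equilibrium x)) (closeP _ _ cvg_stationary).
apply/cvge0_nneg => [n|e e0].
  (* The term at [m = 0] already makes the supremum nonnegative. *)
  apply: le_trans (ereal_sup_ubound _); last by exists 0%N.
  exact: fnorm_ge0.
apply: filterS (main _ e e0) => [n ne|n n1 f Ff].
  by apply: ge_ereal_sup => _ [m _ <-]; apply/fnormE => //; exact: ne.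
(* The premise left over from [cvgmu]: at time 0 both chains sit at [x], so their distance is 0. *)
by rewrite law0// lawoo0// subrr normr0.
Qed.
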